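(* Let $n$ be a positive integer, let $\mathbb{F}$ be a field of characteristic different from $2,3$, and let $H(n)$ be the Heisenberg superalgebra of odd center over $\mathbb{F}$. Let $\widehat{H}(n)$ be the Lie superalgebra and $\widehat{MH}(n)\subset\widehat{H}(n)$ the subsuperspace defined in the context. Then $$0\longrightarrow \widehat{MH}(n)\longrightarrow \widehat{H}(n)\longrightarrow H(n)\longrightarrow 0$$ is a maximal stem extension of $H(n)$. In particular, $\widehat{H}(n)$ is the cover of $H(n)$, and the multiplier $\mathcal{M}(H(n))$ satisfies $$\mathrm{sdim}\,\mathcal{M}(H(n))=\begin{cases}(n^{2}\mid n^{2}-1), & n\geq 2,\\ (1\mid 1), & n=1.\end{cases}$$
   Context: All (super)spaces and (super)algebras are over $\mathbb{F}$. Homomorphisms of Lie superalgebras are even linear maps preserving the bracket; ideals and subsuperspaces are $\mathbb{Z}_2$-graded. The superdimension of a finite-dimensional superspace $V$ is $\mathrm{sdim}V=(\dim V_{\bar 0}\mid\dim V_{\bar 1})$, and pairs are partially ordered by $(m, n)\le(k, l)\iff m\le k$ and $n\le l$. In a basis written $(\ldots\mid\ldots)$ the elements before the bar are even and those after it are odd. A stem extension of a Lie superalgebra $L$ is a short exact sequence of Lie superalgebra homomorphisms $0\to S\to T\to L\to0$ with $S\subset\mathrm{Z}(T)$ and $S\subset[T,T]$. For finite-dimensional $L$ it is called maximal if, among all the stem extensions of $L$, the kernel $S$ is of maximal superdimension with respect to the partial order on pairs given by $(m, n)\le(k, l)\iff m\le k$ and $n\le l$; then $S$ is called a multiplier of $L$,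 denoted $\mathcal{M}(L)$, and $T$ a cover of $L$ (multipliers and covers exist and are unique up to Lie superalgebra isomorphism). The Heisenberg superalgebra $H(n)$ of odd center has basis $(u_1,\ldots,u_n\mid z,w_1,\ldots,w_n)$ with $[u_i,w_i]=-[w_i,u_i]=z$ for $1\le i\le n$, all other brackets of basis elements being zero. Definition of $\widehat{H}(1)$: basis $(\widehat a,\widehat w\mid\widehat b,\widehat c,\widehat m)$ with $[\widehat a,\widehat b]=-[\widehat b,\widehat a]=\widehat c$, $[\widehat a,\widehat c]=-[\widehat c,\widehat a]=\widehat m$, $[\widehat b,\widehat b]=\widehat w$, all other brackets of basis elements being zero; $\widehat{MH}(1)$ is the subsuperspace spanned by $\widehat w,\widehat m$. The map $\widehat{H}(1)\to H(1)$ sends $\widehat a\mapsto u_1$, $\widehat b\mapsto w_1$, $\widehat c\mapsto z$ and kills $\widehat{MH}(1)$. Definition of $\widehat{H}(n)$ for $n\ge2$: the basis consists of the even elements $\widehat a_i$ $(1\le i\le n)$, $\widehat y_{i,j}$ $(1\le i<j\le n)$, $\widehat w_{i,j}$ $(1\le i\le j\le n)$ and the odd elements $\widehat b_i$ $(1\le i\le n)$, $\widehat c$, $\widehat y_i$ $(2\le i\le n)$, $\widehat z_{i,j}$ $(1\le i\ne j\le n)$. The brackets are $[\widehat a_i,\widehat a_j]=-[\widehat a_j,\widehat a_i]=\widehat y_{i,j}$ for $1\le i<j\le n$; $[\widehat a_1,\widehat b_1]=-[\widehat b_1,\widehat a_1]=\widehat c$; $[\widehat a_i,\widehat b_i]=-[\widehat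 b_i,\widehat a_i]=\widehat c+\widehat y_i$ for $2\le i\le n$; $[\widehat a_i,\widehat b_j]=-[\widehat b_j,\widehat a_i]=\widehat z_{i,j}$ for $1\le i\ne j\le n$; $[\widehat b_i,\widehat b_j]=[\widehat b_j,\widehat b_i]=\widehat w_{i,j}$ for $1\le i\le j\le n$; all other brackets of basis elements being zero. $\widehat{MH}(n)$ is the subsuperspace spanned by all $\widehat y_{i,j},\widehat w_{i,j},\widehat y_i,\widehat z_{i,j}$. The map $\widehat H(n)\to H(n)$ sends $\widehat a_i\mapsto u_i$, $\widehat b_i\mapsto w_i$, $\widehat c\mapsto z$ and kills $\widehat{MH}(n)$. *)

(* Defs.v *)
From HB Require Import structures.
From mathcomp Require Import all_boot all_order all_algebra.
Set Implicit Arguments.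
Unset Strict Implicit.
Unset Printing Implicit Defensive.
Import GRing.Theory.
Local Open Scope ring_scope.

(* Parities are booleans: [false] is even, [true] is odd, [(+)] is addition in
   Z/2 and [&&] is multiplication, so that [(-1) ^+ (b && c)] is the sign of
   the Koszul rule.  Subspaces are Prop-valued predicates because the total
   space of an extension is not assumed to be finite-dimensional. *)

Section Subspaces.
Variables (F : fieldType) (V : lmodType F).
Implicit Types S P : V -> Prop.

Definition subspace S : Prop :=
  S 0 /\ forall (a : F) x y, S x -> S y -> S (a *: x + y).

Definition span P : V -> Prop :=
  fun x => forall S, subspace S -> (forall y, P y -> S y) -> S x.

Definition has_dim S (d : nat) : Prop :=
  exists2 e : 'I_d -> V, (forall i, S (e i)) &
    forall x, S x -> exists! c : 'rV[F]_d, x = \sum_i c 0 i *: e i.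

End Subspaces.

(* Over a field of characteristic 3 one would also have to require
   [x, [x, x]] = 0 for odd x, and further axioms in characteristic 2. *)
Record lieSuper (F : fieldType) : Type := LieSuper {
  ls_sort :> lmodType F;
  homog : bool -> ls_sort -> Prop;
  brk : ls_sort -> ls_sort -> ls_sort;
  homog_subspace : forall b, subspace (homog b);
  homog_decomp : forall x, exists x0 x1,
    [/\ homog false x0, homog true x1 & x = x0 + x1];
  homog_direct : forall x, homog false x -> homog true x -> x = 0;
  brk_linearl : forall z a x y, brk (a *: x + y) z = a *: brk x z + brk y z;
  brk_linearr : forall z a x y, brk z (a *: x + y) = a *: brk z x + brk z y;
  brk_even : forall b c x y,
    homog b x -> homog c y -> homog (b (+) c) (brk x y);
  brk_skew : forall b c x y, homog b x -> homog c y ->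
    brk x y = - ((-1) ^+ (b && c) *: brk y x);
  brk_jacobi : forall b c x y z, homog b x -> homog c y ->
    brk x (brk y z) = brk (brk x y) z + (-1) ^+ (b && c) *: brk y (brk x z)
}.

Section LieSuperTheory.
Variable F : fieldType.
Implicit Types L M T : lieSuper F.

Definition is_lie_hom L M (f : L -> M) : Prop :=
  [/\ forall a x y, f (a *: x + y) = a *: f x + f y,
      forall b x, homog b x -> homog b (f x)
    & forall x y, f (brk x y) = brk (f x) (f y)].

Definition lie_isomorphic L M : Prop :=
  exists f : L -> M, is_lie_hom f /\ bijective f.

Definition center L : L -> Prop := fun x => forall y, brk x y = 0.

Definition derived L : L -> Prop := span (fun v => exists x y, v = brk x y).

Definition subsuperspace L (S : L -> Prop) : Prop :=
  subspace S /\
  forall x, S x -> exists x0 x1,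
    [/\ S x0 /\ homog false x0, S x1 /\ homog true x1 & x = x0 + x1].

Definition has_sdim L (S : L -> Prop) (d : nat * nat) : Prop :=
  has_dim (fun x => S x /\ homog false x) d.1 /\
  has_dim (fun x => S x /\ homog true x) d.2.

Definition sdim_le (d d' : nat * nat) : bool :=
  (d.1 <= d'.1)%N && (d.2 <= d'.2)%N.

(* The data of a sequence 0 -> S -> T -> L -> 0, where S is a subset of T and
   S -> T is the inclusion. *)
Record extension L : Type := Extension {
  ext_total : lieSuper F;
  ext_kernel : ext_total -> Prop;
  ext_map : ext_total -> L
}.

Definition stem_extension L (E : extension L) : Prop :=
  [/\ is_lie_hom (@ext_map L E) /\ (forall y, exists x, @ext_map L E x = y),
      subsuperspace (@ext_kernel L E),
      forall x, ext_kernel x <-> @ext_map L E x = 0,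
      forall x, @ext_kernel L E x -> center x
    & forall x, @ext_kernel L E x -> derived x].

(* For finite-dimensional L, the quotient T / Z(T) is finite-dimensional, hence
   so are [T, T] and the kernel of every stem extension: each of them has a
   superdimension in the sense of [has_sdim]. *)
Definition maximal_stem_extension L (E : extension L) : Prop :=
  stem_extension E /\
  exists2 d, has_sdim (@ext_kernel L E) d &
    forall (E' : extension L) d',
      stem_extension E' -> has_sdim (@ext_kernel L E') d' ->
      sdim_le d d' -> d' = d.

Definition is_multiplier L T (S : T -> Prop) : Prop :=
  exists p : T -> L, maximal_stem_extension (Extension S p).

Definition is_cover L T : Prop :=
  exists S : T -> Prop, is_multiplier L S.

End LieSuperTheory.

(* The Lie superalgebra with homogeneous basis B, parities [par] and bracket
   [br x y] of the basis elements x and y; elements are coordinate vectors. *)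
Section FromBasis.
Variables (F : fieldType) (B : finType).
Local Notation V := {ffun B -> F^o}.

Definition bvec (x : B) : V := [ffun z => (z == x)%:R].

Definition obvec (x : option B) : V := if x is Some y then bvec y else 0.

Definition linext (W : lmodType F) (phi : B -> W) (f : V) : W :=
  \sum_x f x *: phi x.

Variables (par : B -> bool) (br : B -> B -> V).

Definition bhomog (b : bool) (f : V) : Prop := forall x, par x != b -> f x = 0.

Definition bbr (f g : V) : V := \sum_x \sum_y (f x * g y) *: br x y.

Lemma bvec_sum (f : V) : f = \sum_x f x *: bvec x.
Proof.
apply/ffunP=> z; rewrite sum_ffunE (bigD1 z) //= big1 => [|x xz].
  by rewrite !ffunE eqxx addr0 [_ *: _]mulr1.
by rewrite !ffunE eq_sym (negbTE xz) [_ *: _]mulr0.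
Qed.

Lemma bbr_linearl g a f f' : bbr (a *: f + f') g = a *: bbr f g + bbr f' g.
Proof.
rewrite /bbr scaler_sumr -big_split; apply: eq_bigr => x _ /=.
rewrite scaler_sumr -big_split; apply: eq_bigr => y _ /=.
by rewrite !ffunE mulrDl scalerDl scalerA mulrA.
Qed.

Lemma bbr_linearr g a f f' : bbr g (a *: f + f') = a *: bbr g f + bbr g f'.
Proof.
rewrite /bbr scaler_sumr -big_split; apply: eq_bigr => x _ /=.
rewrite scaler_sumr -big_split; apply: eq_bigr => y _ /=.
by rewrite !ffunE mulrDr scalerDl scalerA mulrCA.
Qed.

Lemma bbr0l g : bbr 0 g = 0.
Proof. by have := bbr_linearl g (-1) 0 0; rewrite scaler0 addr0 scaleN1r addNr. Qed.

Lemma bbr0r g : bbr g 0 = 0.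
Proof. by have := bbr_linearr g (-1) 0 0; rewrite scaler0 addr0 scaleN1r addNr. Qed.

Lemma bbr_suml I (r : seq I) (c : I -> F) (v : I -> V) g :
  bbr (\sum_(i <- r) c i *: v i) g = \sum_(i <- r) c i *: bbr (v i) g.
Proof.
elim: r => [|i r IH]; first by rewrite !big_nil bbr0l.
by rewrite !big_cons bbr_linearl IH.
Qed.

Lemma bbr_sumr I (r : seq I) (c : I -> F) (v : I -> V) g :
  bbr g (\sum_(i <- r) c i *: v i) = \sum_(i <- r) c i *: bbr g (v i).
Proof.
elim: r => [|i r IH]; first by rewrite !big_nil bbr0r.
by rewrite !big_cons bbr_linearr IH.
Qed.

Lemma bbr_bvecl x g : bbr (bvec x) g = \sum_y g y *: br x y.
Proof.
rewrite /bbr (bigD1 x) //= [X in _ + X]big1 ?addr0 => [|z zx].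
  by apply: eq_bigr => y _; rewrite ffunE eqxx mul1r.
by apply: big1 => y _; rewrite ffunE (negbTE zx) mul0r scale0r.
Qed.

Lemma bbr_bvecr f y : bbr f (bvec y) = \sum_x f x *: br x y.
Proof.
apply: eq_bigr => x _; rewrite (bigD1 y) //= big1 ?addr0 => [|z zy].
  by rewrite ffunE eqxx mulr1.
by rewrite ffunE (negbTE zy) mulr0 scale0r.
Qed.

Lemma bbr_bvec x y : bbr (bvec x) (bvec y) = br x y.
Proof.
rewrite bbr_bvecl (bigD1 y) //= big1 ?addr0 => [|z zy].
  by rewrite ffunE eqxx scale1r.
by rewrite ffunE (negbTE zy) scale0r.
Qed.

Hypothesis br_even : forall x y, bhomog (par x (+) par y) (br x y).
Hypothesis br_skew : forall x y,
  br x y = - ((-1) ^+ (par x && par y) *: br y x).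
Hypothesis br_jacobi : forall x y z,
  bbr (bvec x) (br y z) =
  bbr (br x y) (bvec z) + (-1) ^+ (par x && par y) *: bbr (bvec y) (br x z).

Lemma bhomog_subspace b : subspace (bhomog b).
Proof.
split=> [x _|a f g hf hg x xb]; first by rewrite ffunE.
by rewrite !ffunE hf // hg // scaler0 addr0.
Qed.

Lemma bhomog_decomp f : exists f0 f1,
  [/\ bhomog false f0, bhomog true f1 & f = f0 + f1].
Proof.
exists [ffun x => if par x then 0 else f x], [ffun x => if par x then f x else 0].
split=> [x|x|]; first by rewrite ffunE; case: (par x).
- by rewrite ffunE; case: (par x).
- by apply/ffunP=> x; rewrite !ffunE; case: (par x); rewrite ?add0r ?addr0.
Qed.

Lemma bhomog_direct f : bhomog false f -> bhomog true f -> f = 0.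
Proof.
move=> h0 h1; apply/ffunP=> x; rewrite ffunE.
by case px: (par x); [apply: h0 | apply: h1]; rewrite px.
Qed.

Lemma bbr_even b c f g :
  bhomog b f -> bhomog c g -> bhomog (b (+) c) (bbr f g).
Proof.
move=> hf hg z zbc; rewrite /bbr sum_ffunE big1 // => x _.
rewrite sum_ffunE big1 // => y _; rewrite ffunE.
case: (eqVneq (par x) b) => [xb|/hf->]; last by rewrite mul0r scale0r.
case: (eqVneq (par y) c) => [yc|/hg->]; last by rewrite mulr0 scale0r.
by rewrite br_even ?scaler0 // xb yc.
Qed.

Lemma bbr_skew b c f g : bhomog b f -> bhomog c g ->
  bbr f g = - ((-1) ^+ (b && c) *: bbr g f).
Proof.
move=> hf hg; rewrite /bbr exchange_big scaler_sumr -sumrN.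
apply: eq_bigr => y _; rewrite scaler_sumr -sumrN; apply: eq_bigr => x _ /=.
case: (eqVneq (par x) b) => [xb|/hf->]; last first.
  by rewrite mul0r mulr0 !scale0r scaler0 oppr0.
case: (eqVneq (par y) c) => [yc|/hg->]; last first.
  by rewrite mul0r mulr0 !scale0r scaler0 oppr0.
by rewrite br_skew xb yc scalerN !scalerA mulrC [g y * _]mulrC.
Qed.

Lemma bbr_jacobi b c f g h : bhomog b f -> bhomog c g ->
  bbr f (bbr g h) = bbr (bbr f g) h + (-1) ^+ (b && c) *: bbr g (bbr f h).
Proof.
move=> hf hg; rewrite (bvec_sum h) !bbr_sumr scaler_sumr -big_split.
apply: eq_bigr => z _ /=; rewrite scalerA mulrC -scalerA -scalerDr; congr (_ *: _).
rewrite {1 2}(bvec_sum g) bbr_suml !bbr_sumr bbr_suml.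
rewrite [X in _ = _ + _ *: X](_ : _ =
  \sum_y g y *: bbr (bvec y) (bbr f (bvec z))); last first.
  by rewrite {1}(bvec_sum g) bbr_suml.
rewrite scaler_sumr -big_split; apply: eq_bigr => y _ /=.
case: (eqVneq (par y) c) => [yc|/hg->]; last by rewrite !scale0r scaler0 addr0.
rewrite scalerA mulrC -scalerA -scalerDr; congr (_ *: _).
rewrite (bvec_sum f) !bbr_suml bbr_sumr scaler_sumr -big_split.
apply: eq_bigr => x _ /=.
case: (eqVneq (par x) b) => [xb|/hf->]; last by rewrite !scale0r scaler0 addr0.
rewrite scalerA mulrC -scalerA -scalerDr; congr (_ *: _).
by rewrite !bbr_bvec br_jacobi xb yc.
Qed.

Definition lieSuper_of_basis : lieSuper F :=
  LieSuper bhomog_subspace bhomog_decomp bhomog_direct bbr_linearl bbr_linearr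
    bbr_even bbr_skew bbr_jacobi.

End FromBasis.

Section BasisLemmas.
Variable F : fieldType.

Lemma bvec_homog (B : finType) (par : B -> bool) x b :
  par x = b -> bhomog par b (@bvec F B x).
Proof. by move=> <- z; rewrite ffunE; case: (eqVneq z x) => [->|//]; rewrite eqxx. Qed.

Lemma bhomog0 (B : finType) (par : B -> bool) b :
  bhomog par b (0 : {ffun B -> F^o}).
Proof. by move=> z _; rewrite ffunE. Qed.

Lemma bhomogN (B : finType) (par : B -> bool) b (f : {ffun B -> F^o}) :
  bhomog par b f -> bhomog par b (- f).
Proof. by move=> h z /h fz; rewrite ffunE fz oppr0. Qed.

Lemma bhomogD (B : finType) (par : B -> bool) b (f g : {ffun B -> F^o}) :
  bhomog par b f -> bhomog par b g -> bhomog par b (f + g).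
Proof. by move=> hf hg z zb; rewrite ffunE hf // hg // addr0. Qed.

(* If all brackets are combinations of basis elements which bracket to zero
   with everything, the Jacobi identity is trivial. *)
Lemma jacobi_two_step (B : finType) (par : B -> bool)
    (br : B -> B -> {ffun B -> F^o}) (Z : pred B) :
  (forall x y, bhomog Z true (br x y)) ->
  (forall x y, Z x || Z y -> br x y = 0) ->
  forall x y z, bbr br (bvec F x) (br y z) =
    bbr br (br x y) (bvec F z) +
    (-1) ^+ (par x && par y) *: bbr br (bvec F y) (br x z).
Proof.
move=> brZ brC.
have l x f : bhomog Z true f -> bbr br (bvec F x) f = 0.
  move=> hf; rewrite bbr_bvecl big1 // => y _.
  by case Zy: (Z y); [rewrite brC ?Zy ?orbT ?scaler0 | rewrite hf ?Zy ?scale0r].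
have r x f : bhomog Z true f -> bbr br f (bvec F x) = 0.
  move=> hf; rewrite bbr_bvecr big1 // => y _.
  by case Zy: (Z y); [rewrite brC ?Zy ?scaler0 | rewrite hf ?Zy ?scale0r].
by move=> x y z; rewrite !l ?r // scaler0 addr0.
Qed.

End BasisLemmas.


(* Indices 1 <= i <= n are represented by 'I_n, i.e. shifted to 0 <= i < n. *)
Inductive heis_basis (n : nat) : Type :=
  | H_u of 'I_n
  | H_z
  | H_w of 'I_n.
Arguments H_z {n}.

Section HeisBasisFinite.
Variable n : nat.

Definition heis_code (x : heis_basis n) : 'I_n + (unit + 'I_n) :=
  match x with H_u i => inl i | H_z => inr (inl tt) | H_w i => inr (inr i) end.

Definition heis_decode (s : 'I_n + (unit + 'I_n)) : heis_basis n :=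
  match s with inl i => H_u i | inr (inl _) => H_z | inr (inr i) => H_w i end.

Lemma heis_codeK : cancel heis_code heis_decode. Proof. by case. Qed.

HB.instance Definition _ := Finite.copy (heis_basis n) (can_type heis_codeK).

End HeisBasisFinite.

Section Heis.
Variables (F : fieldType) (n : nat).
Local Notation V := {ffun heis_basis n -> F^o}.
Local Notation e := (@bvec F (heis_basis n)).

Definition heis_par (x : heis_basis n) : bool :=
  if x is H_u _ then false else true.

Definition heis_br (x y : heis_basis n) : V :=
  match x, y with
  | H_u i, H_w j => if i == j then e H_z else 0
  | H_w j, H_u i => - (if i == j then e H_z else 0)
  | _, _ => 0
  end.

Lemma heis_br_even x y : bhomog heis_par (heis_par x (+) heis_par y) (heis_br x y).
Proof.
case: x y => [i||i] [j||j] //=; try exact: bhomog0; try apply: bhomogN;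
  case: eqP => _; by [exact: bhomog0 | exact: bvec_homog].
Qed.

Lemma heis_br_skew x y :
  heis_br x y = - ((-1) ^+ (heis_par x && heis_par y) *: heis_br y x).
Proof.
by case: x y => [i||i] [j||j] //=; rewrite ?scaler0 ?oppr0 ?scale1r ?opprK.
Qed.

Lemma heis_br_jacobi x y z :
  bbr heis_br (bvec F x) (heis_br y z) =
  bbr heis_br (heis_br x y) (bvec F z) +
  (-1) ^+ (heis_par x && heis_par y) *: bbr heis_br (bvec F y) (heis_br x z).
Proof.
apply: (@jacobi_two_step _ _ heis_par _ (fun x => if x is H_z then true else false)).
  move=> {}x {}y; case: x y => [i||i] [j||j] //=; try exact: bhomog0;
    try apply: bhomogN; case: eqP => _; by [exact: bhomog0 | exact: bvec_homog].
by case=> [i||i] [j||j].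
Qed.

Definition heis : lieSuper F :=
  lieSuper_of_basis heis_br_even heis_br_skew heis_br_jacobi.

End Heis.

Inductive hat1_basis : Type := h1_a | h1_w | h1_b | h1_c | h1_m.

Definition hat1_code (x : hat1_basis) : 'I_5 :=
  match x with
  | h1_a => inord 0 | h1_w => inord 1 | h1_b => inord 2 | h1_c => inord 3
  | h1_m => inord 4
  end.

Definition hat1_decode (i : 'I_5) : hat1_basis :=
  nth h1_a [:: h1_a; h1_w; h1_b; h1_c; h1_m] i.

Lemma hat1_codeK : cancel hat1_code hat1_decode.
Proof. by case; rewrite /hat1_decode inordK. Qed.

HB.instance Definition _ := Finite.copy hat1_basis (can_type hat1_codeK).

Section Hat1.
Variable F : fieldType.
Local Notation V := {ffun hat1_basis -> F^o}.
Local Notation e := (@bvec F hat1_basis).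

Definition hat1_par (x : hat1_basis) : bool :=
  match x with h1_a | h1_w => false | h1_b | h1_c | h1_m => true end.

Definition hat1_br (x y : hat1_basis) : V :=
  match x, y with
  | h1_a, h1_b => e h1_c
  | h1_b, h1_a => - e h1_c
  | h1_a, h1_c => e h1_m
  | h1_c, h1_a => - e h1_m
  | h1_b, h1_b => e h1_w
  | _, _ => 0
  end.

Lemma hat1_br_even x y : bhomog hat1_par (hat1_par x (+) hat1_par y) (hat1_br x y).
Proof.
by case: x y => [] [] /=; try exact: bhomog0; try apply: bhomogN; exact: bvec_homog.
Qed.

Lemma hat1_br_skew x y :
  hat1_br x y = - ((-1) ^+ (hat1_par x && hat1_par y) *: hat1_br y x).
Proof.
by case: x y => [] [] /=; rewrite ?scaler0 ?oppr0 // ?scaleN1r ?scale1r ?opprK.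
Qed.

Lemma hat1_br_jacobi x y z :
  bbr hat1_br (bvec F x) (hat1_br y z) =
  bbr hat1_br (hat1_br x y) (bvec F z) +
  (-1) ^+ (hat1_par x && hat1_par y) *: bbr hat1_br (bvec F y) (hat1_br x z).
Proof.
have Nl f g : bbr hat1_br (- f) g = - bbr hat1_br f g.
  by rewrite -[- f]addr0 -scaleN1r bbr_linearl bbr0l addr0 scaleN1r.
have Nr f g : bbr hat1_br f (- g) = - bbr hat1_br f g.
  by rewrite -[- g]addr0 -scaleN1r bbr_linearr bbr0r addr0 scaleN1r.
case: x y z => [] [] [] /=; rewrite ?Nl ?Nr ?bbr0l ?bbr0r ?bbr_bvec /=;
  by rewrite ?scaleN1r ?scale1r ?scalerN ?scaler0 ?oppr0 ?opprK ?addr0 ?add0r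
             ?subrr ?addNr.
Qed.

Definition hat1 : lieSuper F :=
  lieSuper_of_basis hat1_br_even hat1_br_skew hat1_br_jacobi.

Definition hat1_MH : hat1 -> Prop :=
  span (fun v : V => v = e h1_w \/ v = e h1_m).

Definition hat1_map : hat1 -> heis F 1 :=
  linext (fun x => match x with
                   | h1_a => bvec F (H_u ord0)
                   | h1_b => bvec F (H_w ord0)
                   | h1_c => bvec F H_z
                   | h1_w | h1_m => 0
                   end).

End Hat1.

(* \hat H(n) for n >= 2. *)
Inductive hatn_basis (n : nat) : Type :=
  | h_a of 'I_n
  | h_yy of {p : 'I_n * 'I_n | (p.1 < p.2)%N}
  | h_w of {p : 'I_n * 'I_n | (p.1 <= p.2)%N}
  | h_b of 'I_n
  | h_c
  | h_y of {i : 'I_n | (0 < i)%N}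
  | h_z of {p : 'I_n * 'I_n | p.1 != p.2}.
Arguments h_c {n}.

Section HatnBasisFinite.
Variable n : nat.
Local Notation code_type :=
  ('I_n + ({p : 'I_n * 'I_n | (p.1 < p.2)%N} +
    ({p : 'I_n * 'I_n | (p.1 <= p.2)%N} + ('I_n + (unit +
      ({i : 'I_n | (0 < i)%N} + {p : 'I_n * 'I_n | p.1 != p.2}))))))%type.

Definition hatn_code (x : hatn_basis n) : code_type :=
  match x with
  | h_a i => inl i
  | h_yy p => inr (inl p)
  | h_w p => inr (inr (inl p))
  | h_b i => inr (inr (inr (inl i)))
  | h_c => inr (inr (inr (inr (inl tt))))
  | h_y i => inr (inr (inr (inr (inr (inl i)))))
  | h_z p => inr (inr (inr (inr (inr (inr p)))))
  end.

Definition hatn_decode (s : code_type) : hatn_basis n :=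
  match s with
  | inl i => h_a i
  | inr (inl p) => h_yy p
  | inr (inr (inl p)) => h_w p
  | inr (inr (inr (inl i))) => h_b i
  | inr (inr (inr (inr (inl _)))) => h_c
  | inr (inr (inr (inr (inr (inl i))))) => h_y i
  | inr (inr (inr (inr (inr (inr p))))) => h_z p
  end.

Lemma hatn_codeK : cancel hatn_code hatn_decode. Proof. by case. Qed.

HB.instance Definition _ := Finite.copy (hatn_basis n) (can_type hatn_codeK).

End HatnBasisFinite.

Section Hatn.
Variables (F : fieldType) (n : nat).
Local Notation V := {ffun hatn_basis n -> F^o}.
Local Notation e := (@bvec F (hatn_basis n)).
Local Notation oe := (@obvec F (hatn_basis n)).

(* Vectors of the basis with unrestricted indices; by [insub], each of these is
   zero when its indices violate the constraint of the corresponding family. *)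
Definition v_yy (i j : 'I_n) : V := oe (omap (@h_yy n) (insub (i, j))).
Definition v_w (i j : 'I_n) : V := oe (omap (@h_w n) (insub (i, j))).
Definition v_y (i : 'I_n) : V := oe (omap (@h_y n) (insub i)).
Definition v_z (i j : 'I_n) : V := oe (omap (@h_z n) (insub (i, j))).

Definition hatn_par (x : hatn_basis n) : bool :=
  match x with
  | h_a _ | h_yy _ | h_w _ => false
  | h_b _ | h_c | h_y _ | h_z _ => true
  end.

Definition hatn_ab (i j : 'I_n) : V :=
  if i == j then e h_c + v_y i else v_z i j.

(* In [h_a i, h_a j] at most one of the two terms is nonzero. *)
Definition hatn_br (x y : hatn_basis n) : V :=
  match x, y with
  | h_a i, h_a j => v_yy i j - v_yy j i
  | h_a i, h_b j => hatn_ab i j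
  | h_b j, h_a i => - hatn_ab i j
  | h_b i, h_b j => if (i <= j)%N then v_w i j else v_w j i
  | _, _ => 0
  end.

Lemma v_homog T (P : pred T) (S : subType P) (k : S -> hatn_basis n) par b (x : T) :
  (forall s, par (k s) = b) -> bhomog par b (oe (omap k (insub x))).
Proof.
by move=> h; case: insub => [s|] /=; [exact: bvec_homog | exact: bhomog0].
Qed.

Lemma hatn_ab_homog (par : hatn_basis n -> bool) i j :
  par h_c -> (forall s, par (h_y s)) -> (forall s, par (h_z s)) ->
  bhomog par true (hatn_ab i j).
Proof.
move=> pc py pz; rewrite /hatn_ab; case: eqP => _; last exact: v_homog.
by apply: bhomogD; [exact: bvec_homog | exact: v_homog].
Qed.

Lemma hatn_br_even x y : bhomog hatn_par (hatn_par x (+) hatn_par y) (hatn_br x y).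
Proof.
case: x y => [i|p|p|i||p|p] [j|q|q|j||q|q] /=; try exact: bhomog0.
- by apply: bhomogD; [|apply: bhomogN]; exact: v_homog.
- exact: hatn_ab_homog.
- by apply: bhomogN; exact: hatn_ab_homog.
- by case: ifP => _; exact: v_homog.
Qed.

Lemma hatn_br_skew x y :
  hatn_br x y = - ((-1) ^+ (hatn_par x && hatn_par y) *: hatn_br y x).
Proof.
case: x y => [i|p|p|i||p|p] [j|q|q|j||q|q] /=; rewrite ?scaler0 ?oppr0 //.
- by rewrite scale1r opprB.
- by rewrite scale1r opprK.
- by rewrite scale1r.
- rewrite scaleN1r opprK; case: (ltngtP i j) => // ij.
  by rewrite (val_inj ij : i = j).
Qed.

Lemma hatn_br_jacobi x y z :
  bbr hatn_br (bvec F x) (hatn_br y z) =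
  bbr hatn_br (hatn_br x y) (bvec F z) +
  (-1) ^+ (hatn_par x && hatn_par y) *: bbr hatn_br (bvec F y) (hatn_br x z).
Proof.
apply: (@jacobi_two_step _ _ hatn_par _
  (fun x => match x with h_a _ | h_b _ => false | _ => true end)).
  move=> {}x {}y.
  case: x y => [i|p|p|i||p|p] [j|q|q|j||q|q] /=; try exact: bhomog0.
  - by apply: bhomogD; [|apply: bhomogN]; exact: v_homog.
  - exact: hatn_ab_homog.
  - by apply: bhomogN; exact: hatn_ab_homog.
  - by case: ifP => _; exact: v_homog.
by case=> [i|p|p|i||p|p] [j|q|q|j||q|q].
Qed.

Definition hatn : lieSuper F :=
  lieSuper_of_basis hatn_br_even hatn_br_skew hatn_br_jacobi.

Definition hatn_MH : hatn -> Prop :=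
  span (fun v : V => (exists p, v = e (h_yy p)) \/ (exists p, v = e (h_w p)) \/
                     (exists i, v = e (h_y i)) \/ (exists p, v = e (h_z p))).

Definition hatn_map : hatn -> heis F n :=
  linext (fun x => match x with
                   | h_a i => bvec F (H_u i)
                   | h_b i => bvec F (H_w i)
                   | h_c => bvec F H_z
                   | h_yy _ | h_w _ | h_y _ | h_z _ => 0
                   end).

End Hatn.

Definition hatH (F : fieldType) (n : nat) : lieSuper F :=
  match n with 1 => hat1 F | m => hatn F m end.

Definition hatMH (F : fieldType) (n : nat) : hatH F n -> Prop :=
  match n return hatH F n -> Prop with
  | 1 => @hat1_MH F
  | m => @hatn_MH F m
  end.

Definition hatH_map (F : fieldType) (n : nat) : hatH F n -> heis F n :=
  match n return hatH F n -> heis F n with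
  | 1 => @hat1_map F
  | m => @hatn_map F m
  end.

Definition hat_extension (F : fieldType) (n : nat) : extension (heis F n) :=
  Extension (@hatMH F n) (@hatH_map F n).

(* Main.v *)
Require Import Defs.
From HB Require Import structures.
From mathcomp Require Import all_boot all_order all_algebra.
From mathcomp Require Import zify.

Set Implicit Arguments.
Unset Strict Implicit.
Unset Printing Implicit Defensive.
Import GRing.Theory.
Local Open Scope ring_scope.

(** Why the theorem is true. Let [T -> H(n)] be any stem extension, with kernel
    [S], and choose homogeneous lifts [a_i], [b_i] in [T] of [u_i], [w_i]
    ([heis_lifts]). A bracket of lifts whose image in [H(n)] vanishes lies in
    [S], hence is central, and so is the difference of two lifts of [z]; so
    brackets in [T] are governed by the values [[a_i, a_j]], [[b_i, b_j]],
    [[a_i, b_j]], together with the brackets with [c = [a_1, b_1]].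
    For [n > 1] one may replace [c] by [[a_j, b_j]] with [j] different from [k]
    when bracketing it with [a_k] or [b_k], and the Jacobi identity shows that
    the result is zero. For [n = 1] this freedom is absent: [[a, c]] may survive,
    while the Jacobi identity for [a, b, b] gives [2 [b, c] = 0]. Either way,
    the relations of the algebra with a hat hold in [T], so sending its
    basis to the lifts and their brackets is a homomorphism to [T] over [H(n)]:
    the hat extension maps to every stem extension ([hat1_weakly_initial],
    [hatn_weakly_initial]).

    The rest holds over any Lie superalgebra. A morphism between stem extensions
    is always onto ([stem_morphism_onto]), since [S] lies in [[T, T]] and central
    elements do not contribute to [[T, T]]; it maps kernel onto kernel, degree by
    degree. So the superdimension of every kernel is bounded by that of a weakly
    initial stem extension, which is therefore maximal, and in case of equality
    the morphism is an isomorphism by counting dimensions. It remains to see that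
    the hat extension is stem ([hat1_stem], [hatn_stem]) and to count the basis of
    its kernel. *)

(** * Linear algebra *)

Section LinearMaps.
Variables (F : fieldType) (V W : lmodType F) (f : V -> W).
Hypothesis f_lin : forall a x y, f (a *: x + y) = a *: f x + f y.

Lemma lin0 : f 0 = 0.
Proof. by have := f_lin (-1) 0 0; rewrite scaler0 addr0 scaleN1r addNr. Qed.

Lemma linD x y : f (x + y) = f x + f y.
Proof. by rewrite -[x]scale1r f_lin !scale1r. Qed.

Lemma linZ a x : f (a *: x) = a *: f x.
Proof. by rewrite -[a *: x]addr0 f_lin lin0 addr0. Qed.

Lemma linN x : f (- x) = - f x.
Proof. by rewrite -scaleN1r linZ scaleN1r. Qed.

Lemma linB x y : f (x - y) = f x - f y.
Proof. by rewrite linD linN. Qed.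

Lemma lin_sum I (r : seq I) (c : I -> F) (v : I -> V) :
  f (\sum_(i <- r) c i *: v i) = \sum_(i <- r) c i *: f (v i).
Proof.
elim: r => [|i r IH]; first by rewrite !big_nil lin0.
by rewrite !big_cons f_lin IH.
Qed.

(** In coordinates [f] is a matrix [A'], and lifting a basis of the target gives
    [B'] with [B' A' = 1]; if the sizes agree then [A' B' = 1] too. *)
Lemma has_dim_onto (S : V -> Prop) (S' : W -> Prop) d d' :
  (forall x, S x -> S' (f x)) -> (forall y, S' y -> exists2 x, S x & f x = y) ->
  has_dim S d -> has_dim S' d' ->
  (d' <= d)%N /\ (d = d' -> forall x, S x -> f x = 0 -> x = 0).
Proof.
move=> fS fonto [e eS e_basis] [e' eS' e_basis'].
have /fin_all_exists[A fe] : forall i, exists c : 'rV[F]_d',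
    f (e i) = \sum_j c 0 j *: e' j.
  move=> i; have [c [cE _]] := e_basis' _ (fS _ (eS i)).
  by exists c.
have /fin_all_exists[B fB] : forall j, exists c : 'rV[F]_d,
    f (\sum_i c 0 i *: e i) = e' j.
  move=> j; have [x /e_basis[c [-> _]] fx] := fonto _ (eS' j).
  by exists c.
pose A' := \matrix_i A i; pose B' := \matrix_j B j.
have fsum (c : 'rV[F]_d) : f (\sum_i c 0 i *: e i) = \sum_j (c *m A') 0 j *: e' j.
  rewrite lin_sum (eq_bigr (fun i => \sum_j (c 0 i * A' i j) *: e' j)).
    by rewrite exchange_big; apply: eq_bigr => j _; rewrite mxE scaler_suml.
  move=> i _; rewrite fe scaler_sumr; apply: eq_bigr => j _.
  by rewrite scalerA mxE.
have uniq' (c c' : 'rV[F]_d') : S' (\sum_j c 0 j *: e' j) ->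
    \sum_j c 0 j *: e' j = \sum_j c' 0 j *: e' j -> c = c'.
  by move=> /e_basis'[c0 [_ c0_uniq]] cc'; rewrite -(c0_uniq c) // -(c0_uniq c').
have BA1 : B' *m A' = 1%:M.
  apply/row_matrixP=> j; rewrite row_mul rowK row1.
  apply: uniq'; rewrite -fsum fB; first exact: eS'.
  rewrite (bigD1 j) //= mxE !eqxx scale1r big1 ?addr0 // => k kj.
  by rewrite mxE eqxx (negbTE kj) scale0r.
split=> [|dd']; first exact: mulmx1_min BA1.
move=> x Sx fx0; have [c [xE _]] := e_basis x Sx.
subst d'; have AB1 := mulmx1C BA1.
have cA0 : c *m A' = 0.
  apply: uniq'; first by rewrite -fsum -xE; apply: fS.
  rewrite -fsum -xE fx0 big1 // => j _; by rewrite mxE scale0r.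
by rewrite xE -[c]mulmx1 -AB1 mulmxA cA0 mul0mx big1 // => j _; rewrite mxE scale0r.
Qed.

End LinearMaps.

Lemma eq_opp_eq0 (F : fieldType) (V : lmodType F) (x : V) :
  2%N \notin [pchar F] -> x = - x -> x = 0.
Proof.
rewrite inE /= => char2 xN.
apply/eqP; have: 2%:R *: x = 0 by rewrite scaler_nat mulr2n {1}xN addNr.
by move/eqP; rewrite scaler_eq0 (negbTE char2).
Qed.

(** * Lie superalgebras and stem extensions *)

Section Stem.
Variable F : fieldType.
Implicit Types L T : lieSuper F.

Lemma homogS L b : subspace (@homog F L b). Proof. exact: homog_subspace. Qed.

Lemma homogD L b (x y : L) : homog b x -> homog b y -> homog b (x + y).
Proof. by move=> hx hy; rewrite -[x]scale1r; apply: (homogS L b).2. Qed.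

Lemma homogN L b (x : L) : homog b x -> homog b (- x).
Proof.
by move=> hx; rewrite -scaleN1r -[_ *: x]addr0; apply/(homogS L b).2/(homogS L b).1.
Qed.

Lemma homogB L b (x y : L) : homog b x -> homog b y -> homog b (x - y).
Proof. by move=> hx /homogN; apply: homogD. Qed.

Lemma homog_disjoint L b (x : L) : homog b x -> homog (~~ b) x -> x = 0.
Proof. by case: b => h h'; apply: homog_direct. Qed.

Lemma homog_split L b (x : L) :
  exists y z, [/\ homog b y, homog (~~ b) z & x = y + z].
Proof.
have [x0 [x1 [h0 h1 ->]]] := homog_decomp x.
by case: b; [exists x1, x0; rewrite addrC | exists x0, x1].
Qed.

(** The homogeneous component of the right parity of any preimage works, as
    the other component is sent to a vector of both parities. *)
Lemma homog_lift L T (p : T -> L) b (y : L) :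
  is_lie_hom p -> (exists x, p x = y) -> homog b y ->
  exists x, homog b x /\ p x = y.
Proof.
move=> [p_lin p_homog _] [x <-] hb.
have [x0 [x1 [h0 h1 xE]]] := homog_split b x.
exists x0; split=> //; have: p x1 = 0.
  apply: (homog_disjoint (b := b)); last exact: p_homog.
  have -> : x1 = x - x0 by rewrite xE addrC addKr.
  by rewrite (linB p_lin); apply: homogB => //; apply: p_homog.
by rewrite xE (linD p_lin) => ->; rewrite addr0.
Qed.

Lemma brkl0 L (x : L) : brk 0 x = 0.
Proof. exact: lin0 (brk_linearl x). Qed.

Lemma stem_center_r L (E : extension L) (x s : ext_total E) :
  stem_extension E -> ext_kernel s -> brk x s = 0.
Proof.
move=> [_ [_ Ss] _ Sc _] /Ss[s0 [s1 [[S0 h0] [S1 h1] ->]]].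
have [x0 [x1 [hx0 hx1 ->]]] := homog_decomp x.
have z b c (y t : ext_total E) : homog b y -> homog c t -> ext_kernel t -> brk y t = 0.
  by move=> hy ht St; rewrite (brk_skew hy ht) (Sc t St) scaler0 oppr0.
rewrite (linD (brk_linearl _)) !(linD (brk_linearr _)).
by rewrite (z _ _ _ _ hx0 h0) // (z _ _ _ _ hx0 h1) // (z _ _ _ _ hx1 h0) //
           (z _ _ _ _ hx1 h1) // !addr0.
Qed.

Definition stem_morphism L (E E' : extension L)
    (phi : ext_total E -> ext_total E') : Prop :=
  is_lie_hom phi /\ forall x, ext_map (phi x) = ext_map x.

(** If [im] is the image, then [T = im + S] because both extensions project onto
    the same algebra. As [S] is central, [[T, T] = [im, im]] lies in [im]; the
    stem condition then puts [S], hence all of [T], into [im]. *)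
Lemma stem_morphism_onto L (E E' : extension L) phi :
  stem_extension E -> stem_extension E' -> @stem_morphism L E E' phi ->
  forall y, exists x, phi x = y.
Proof.
move=> [[_ p_onto] _ _ _ _] st' [[phi_lin _ phi_brk] phi_p].
have [[[p'_lin _ _] _] _ kerE' Sc' Sd'] := st'.
have im_sub : subspace (fun y => exists x, phi x = y).
  split=> [|a _ _ [x <-] [y <-]]; first by exists 0; rewrite (lin0 phi_lin).
  by exists (a *: x + y); rewrite phi_lin.
have split_im y : exists x s, ext_kernel s /\ y = phi x + s.
  have [x px] := p_onto (ext_map y); exists x, (y - phi x).
  split; last by rewrite addrC subrK.
  by apply/kerE'; rewrite (linB p'_lin) phi_p px subrr.
have im_der y : derived y -> exists x, phi x = y.
  move=> dy; apply: (dy _ im_sub) => _ [u [v ->]].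
  have [x [s [Ss ->]]] := split_im u; have [x' [s' [Ss' ->]]] := split_im v.
  exists (brk x x'); rewrite phi_brk (linD (brk_linearl _)) (Sc' _ Ss) addr0.
  by rewrite (linD (brk_linearr _)) (stem_center_r _ st' Ss') addr0.
move=> y; have [x [s [/Sd' /im_der[x' <-] ->]]] := split_im y.
by exists (x + x'); rewrite (linD phi_lin).
Qed.

Lemma stem_morphism_ker L (E E' : extension L) phi x :
  stem_extension E -> stem_extension E' -> @stem_morphism L E E' phi ->
  ext_kernel (phi x) <-> ext_kernel x.
Proof.
move=> [_ _ kE _ _] [_ _ kE' _ _] [_ pE].
by split=> [/kE'|/kE] px; [apply/kE | apply/kE']; rewrite ?pE // -pE.
Qed.

Lemma stem_morphism_ker_onto L (E E' : extension L) phi b y :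
  stem_extension E -> stem_extension E' -> @stem_morphism L E E' phi ->
  ext_kernel y /\ homog b y ->
  exists2 x, ext_kernel x /\ homog b x & phi x = y.
Proof.
move=> st st' mor [Sy hy].
have [x [hx xy]] := homog_lift mor.1 (stem_morphism_onto st st' mor y) hy.
by exists x => //; split=> //; apply/(stem_morphism_ker x st st' mor); rewrite xy.
Qed.

Lemma stem_morphism_dim L (E E' : extension L) phi b d d' :
  stem_extension E -> stem_extension E' -> @stem_morphism L E E' phi ->
  has_dim (fun x => @ext_kernel _ _ E x /\ homog b x) d ->
  has_dim (fun x => @ext_kernel _ _ E' x /\ homog b x) d' ->
  (d' <= d)%N /\
  (d = d' -> forall x, ext_kernel x /\ homog b x -> phi x = 0 -> x = 0).
Proof.
move=> st st' mor; have [[phi_lin phi_homog _] _] := mor.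
apply: has_dim_onto => // [x [Sx hx]|y]; last exact: stem_morphism_ker_onto.
by split; [apply/(stem_morphism_ker x st st' mor) | apply: phi_homog].
Qed.

(** The kernel of [phi] lies in that of [E], which is graded, so
    injectivity may be tested on the homogeneous parts of the latter, where it
    follows by counting dimensions. *)
Lemma stem_morphism_inj L (E E' : extension L) phi d :
  stem_extension E -> stem_extension E' -> @stem_morphism L E E' phi ->
  has_sdim (@ext_kernel _ _ E) d -> has_sdim (@ext_kernel _ _ E') d ->
  injective phi.
Proof.
move=> st st' mor [d0 d1] [d0' d1'].
have [_ inj0] := stem_morphism_dim st st' mor d0 d0'.
have [_ inj1] := stem_morphism_dim st st' mor d1 d1'.
have [[phi_lin phi_homog _] _] := mor; have [_ [_ Ss] _ _ _] := st.
suff ker0 x : phi x = 0 -> x = 0.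
  by move=> x y xy; apply/subr0_eq/ker0; rewrite (linB phi_lin) xy subrr.
move=> x0; have: ext_kernel x.
  apply/(stem_morphism_ker x st st' mor); rewrite x0.
  by have [_ [[]]] := st'.
move=> /Ss[y [z [Sy Sz xE]]]; move: x0; rewrite xE (linD phi_lin) => yz0.
have yNz : phi y = - phi z by apply/eqP; rewrite -addr_eq0 yz0.
have y0 : phi y = 0.
  apply: homog_direct; first exact: phi_homog Sy.2.
  by rewrite yNz; apply/homogN/phi_homog/Sz.2.
have z0 : phi z = 0 by move: yz0; rewrite y0 add0r.
by rewrite (inj0 erefl _ Sy y0) (inj1 erefl _ Sz z0) addr0.
Qed.

(** The inverse function comes from the choice operator of the carrier of [L],
    which applies as equality in [T] is decidable. *)
Lemma lie_isomorphic_sym_of_bij L T (phi : L -> T) :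
  is_lie_hom phi -> injective phi -> (forall y, exists x, phi x = y) ->
  lie_isomorphic T L.
Proof.
move=> hom phi_inj phi_onto; have [phi_lin phi_homog phi_brk] := hom.
have onto y : exists x, phi x == y by have [x <-] := phi_onto y; exists x.
pose psi y := xchoose (onto y).
have psiK y : phi (psi y) = y by apply/eqP/(xchooseP (onto y)).
have phiK x : psi (phi x) = x by apply: phi_inj; rewrite psiK.
exists psi; split; last by exists phi.
split=> [a x y|b y hy|x y].
- by apply: phi_inj; rewrite phi_lin !psiK.
- have [x [hx <-]] := homog_lift hom (phi_onto y) hy.
  by rewrite phiK.
- by apply: phi_inj; rewrite phi_brk !psiK.
Qed.

(** Only weakly: in general the morphism is not unique, as the images of
    generators may be changed by central elements. *)
Definition weakly_initial L (E : extension L) : Prop :=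
  forall E' : extension L, stem_extension E' ->
    exists phi, @stem_morphism L E E' phi.

Lemma weakly_initial_sdim L (E E' : extension L) d d' :
  stem_extension E -> weakly_initial E -> has_sdim (@ext_kernel _ _ E) d ->
  stem_extension E' -> has_sdim (@ext_kernel _ _ E') d' -> sdim_le d' d.
Proof.
move=> st init [d0 d1] st' [d0' d1']; have [phi mor] := init _ st'.
apply/andP; split; first by have [] := stem_morphism_dim st st' mor d0 d0'.
by have [] := stem_morphism_dim st st' mor d1 d1'.
Qed.

Lemma sdim_le_anti d d' : sdim_le d d' -> sdim_le d' d -> d' = d.
Proof.
case: d d' => [a b] [a' b'] /andP[/= aa' bb'] /andP[/= a'a b'b].
by congr pair; apply/eqP; rewrite eqn_leq ?aa' ?a'a ?bb' ?b'b.
Qed.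

Lemma weakly_initial_maximal L (E : extension L) d :
  stem_extension E -> weakly_initial E -> has_sdim (@ext_kernel _ _ E) d ->
  maximal_stem_extension E.
Proof.
move=> st init dE; split=> //; exists d => // E' d' st' dE' le_dd'.
exact: sdim_le_anti le_dd' (weakly_initial_sdim st init dE st' dE').
Qed.

Lemma weakly_initial_multiplier L (E : extension L) d T (S : T -> Prop) :
  stem_extension E -> weakly_initial E -> has_sdim (@ext_kernel _ _ E) d ->
  is_multiplier L S -> has_sdim S d.
Proof.
move=> st init dE [p [st' [d' dE' max']]].
by rewrite (max' E d st dE (weakly_initial_sdim st init dE st' dE')).
Qed.

Lemma weakly_initial_cover L (E : extension L) d T :
  stem_extension E -> weakly_initial E -> has_sdim (@ext_kernel _ _ E) d ->
  is_cover L T -> lie_isomorphic T (ext_total E).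
Proof.
move=> st init dE [S mS].
have dS := weakly_initial_multiplier st init dE mS.
have [p [st' _]] := mS; have [phi mor] := init _ st'.
apply: (lie_isomorphic_sym_of_bij mor.1); last exact: stem_morphism_onto mor.
exact: (stem_morphism_inj st st' mor dE dS).
Qed.

End Stem.

(** * Algebras given by a basis *)

Section Linext.
Variables (F : fieldType) (B : finType) (W : lmodType F) (phi : B -> W).

Lemma linext_lin a f g :
  linext phi (a *: f + g) = a *: linext phi f + linext phi g.
Proof.
rewrite /linext scaler_sumr -big_split; apply: eq_bigr => x _ /=.
by rewrite !ffunE scalerDl scalerA.
Qed.

Lemma linext_bvec x : linext phi (bvec F x) = phi x.
Proof.
rewrite /linext (bigD1 x) //= big1 => [|y yx].
  by rewrite ffunE eqxx scale1r addr0.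
by rewrite ffunE (negbTE yx) scale0r.
Qed.

Lemma linext_insub (A : Type) (P : pred A) (S : subType P) (k : S -> B) g x :
  (forall s, phi (k s) = g (val s)) ->
  linext phi (obvec F (omap k (insub x))) = if P x then g x else 0.
Proof.
move=> phik; case: insubP => [s Px sx|/negbTE nPx] /=.
  by rewrite Px linext_bvec phik sx.
by rewrite nPx (lin0 linext_lin).
Qed.

End Linext.

Lemma lin_linext (F : fieldType) (B : finType) (V W : lmodType F) (f : V -> W)
    (phi : B -> V) (psi : B -> W) :
  (forall a x y, f (a *: x + y) = a *: f x + f y) ->
  (forall x, f (phi x) = psi x) -> forall v, f (linext phi v) = linext psi v.
Proof.
move=> f_lin fphi v; rewrite /linext (lin_sum f_lin).
by apply: eq_bigr => x _; rewrite fphi.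
Qed.

Section CoordinateSubspaces.
Variables (F : fieldType) (B : finType).
Local Notation V := {ffun B -> F^o}.

Definition supported (Q : pred B) (f : V) : Prop := forall x, ~~ Q x -> f x = 0.

Lemma supported_subspace Q : subspace (supported Q).
Proof.
split=> [x _|a f g hf hg x nQx]; first by rewrite ffunE.
by rewrite !ffunE hf // hg // scaler0 addr0.
Qed.

Lemma span_supported (Q : pred B) (P : V -> Prop) f :
  (forall x, Q x -> P (bvec F x)) ->
  (forall v, P v -> exists2 x, Q x & v = bvec F x) ->
  Defs.span P f <-> supported Q f.
Proof.
move=> QP PQ; split=> [|suppf S [S0 Slin] PS].
  apply; first exact: supported_subspace.
  move=> _ /PQ[x Qx ->] y; rewrite ffunE; case: eqP => // ->.
  by rewrite Qx.
rewrite (bvec_sum f); elim/big_ind: _ => // [x y Sx Sy|x _].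
  by rewrite -[x]scale1r; apply: Slin.
have [Qx|/suppf->] := boolP (Q x); last by rewrite scale0r.
by rewrite -[_ *: _]addr0; apply: Slin => //; apply/PS/QP.
Qed.

Lemma supported_dim (Q : pred B) (S : V -> Prop) :
  (forall f, S f <-> supported Q f) -> has_dim S #|Q|.
Proof.
move=> SE; exists (fun i => bvec F (enum_val i)) => [i|f /SE suppf].
  apply/SE => x; rewrite ffunE; case: eqP => // -> /negP[].
  exact: enum_valP.
have coord (c : 'rV[F]_#|Q|) j :
    (\sum_i c 0 i *: bvec F (enum_val i)) (enum_val j) = c 0 j.
  rewrite sum_ffunE (bigD1 j) //= big1 ?addr0 => [|i ij].
    by rewrite !ffunE eqxx [_ *: _]mulr1.
  rewrite !ffunE (inj_eq enum_val_inj) eq_sym (negbTE ij); exact: scaler0.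
exists (\row_i f (enum_val i)); split=> [|c ->]; last first.
  by apply/rowP=> j; rewrite mxE coord.
apply/ffunP=> x; have [Qx|nQx] := boolP (Q x).
  by rewrite -(enum_rankK_in Qx Qx) coord mxE.
rewrite suppf // sum_ffunE big1 // => i _; rewrite !ffunE.
case: eqP => [xE|_]; last exact: scaler0.
by move: nQx; rewrite xE => /negP[]; exact: enum_valP.
Qed.

End CoordinateSubspaces.

Section BasisMaps.
Variables (F : fieldType) (B : finType) (par : B -> bool).
Variable br : B -> B -> {ffun B -> F^o}.
Hypothesis br_even : forall x y, bhomog par (par x (+) par y) (br x y).
Hypothesis br_skew : forall x y,
  br x y = - ((-1) ^+ (par x && par y) *: br y x).
Hypothesis br_jacobi : forall x y z,
  bbr br (bvec F x) (br y z) = bbr br (br x y) (bvec F z) +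
    (-1) ^+ (par x && par y) *: bbr br (bvec F y) (br x z).
Local Notation A := (lieSuper_of_basis br_even br_skew br_jacobi).

(** Parity and bracket need only be checked on the basis, by bilinearity. *)
Lemma linext_lie_hom (T : lieSuper F) (phi : B -> T) :
  (forall x, homog (par x) (phi x)) ->
  (forall x y, brk (phi x) (phi y) = linext phi (br x y)) ->
  @is_lie_hom F A T (linext phi).
Proof.
move=> phi_par phi_brk; split=> [a x y|b f hf|f g].
- exact: linext_lin.
- rewrite /linext; elim/big_ind: _ => [|x y|x _]; first exact: (homogS T b).1.
    exact: homogD.
  have [<-|/hf->] := eqVneq (par x) b; last by rewrite scale0r; apply: (homogS T b).1.
  by rewrite -[_ *: _]addr0; apply: (homogS T _).2 => //; apply: (homogS T _).1.
- rewrite {1}(bvec_sum f) [brk _ _]bbr_suml (lin_sum (linext_lin phi)).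
  rewrite [in RHS]/linext (lin_sum (brk_linearl _)); apply: eq_bigr => x _.
  rewrite {1}(bvec_sum g) bbr_sumr (lin_sum (linext_lin phi)).
  rewrite (lin_sum (brk_linearr _)); congr (_ *: _); apply: eq_bigr => y _.
  by rewrite bbr_bvec phi_brk.
Qed.

Variables (B' : finType) (par' : B' -> bool).
Variable br' : B' -> B' -> {ffun B' -> F^o}.
Hypothesis br_even' : forall x y, bhomog par' (par' x (+) par' y) (br' x y).
Hypothesis br_skew' : forall x y,
  br' x y = - ((-1) ^+ (par' x && par' y) *: br' y x).
Hypothesis br_jacobi' : forall x y z,
  bbr br' (bvec F x) (br' y z) = bbr br' (br' x y) (bvec F z) +
    (-1) ^+ (par' x && par' y) *: bbr br' (bvec F y) (br' x z).
Local Notation A' := (lieSuper_of_basis br_even' br_skew' br_jacobi').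

Lemma linext_section (q : B -> option B') (k : B' -> B) f y :
  pcancel k q -> ocancel q k -> linext (fun x => obvec F (q x)) f y = f (k y).
Proof.
move=> kq qk; rewrite sum_ffunE (bigD1 (k y)) //= big1 => [|x xky].
  by rewrite addr0 ffunE kq ffunE eqxx [_ *: _]mulr1.
rewrite ffunE; case qx: (q x) => [y'|]; last by rewrite ffunE scaler0.
rewrite ffunE; case: eqP => [yy'|_]; last exact: scaler0.
by case/eqP: xky; rewrite -[LHS]qk qx yy'.
Qed.

(** The map given by [q] on bases, where [None] stands for zero, splits along the
    injection [k] of the target basis. Its kernel is then a coordinate subspace,
    and every condition on a stem extension reduces to one on the basis elements
    that [q] kills. *)
Lemma stem_of_basis_map (q : B -> option B') (k : B' -> B)
    (S : A -> Prop) (p : A -> A') :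
  pcancel k q -> ocancel q k ->
  (forall f, p f = linext (fun x => obvec F (q x)) f) ->
  (forall f, S f <-> supported (fun x => ~~ q x) f) ->
  (forall y, par (k y) = par' y) ->
  (forall x y, bbr br' (obvec F (q x)) (obvec F (q y)) =
               linext (fun z => obvec F (q z)) (br x y)) ->
  (forall x y, ~~ q x -> br x y = 0) ->
  (forall x, ~~ q x -> @derived F A (bvec F x)) ->
  stem_extension (@Extension F A' A S p).
Proof.
move=> kq qk pE SE park p_brk q_center q_der.
have [p_lin p_homog p_brk'] :
    @is_lie_hom F A A' (linext (fun x => obvec F (q x))).
  apply: linext_lie_hom => // x; case qx: (q x) => [y|]; last exact: bhomog0.
  by apply: bvec_homog; rewrite -park -[x]qk qx.
have pk f y : p f y = f (k y) by rewrite pE; apply: linext_section.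
split=> /=.
- split; first by split=> [a f g|b f /p_homog|f g]; rewrite !pE.
  move=> g; exists (linext (fun y => bvec F (k y)) g).
  apply/ffunP=> y; rewrite pk sum_ffunE (bigD1 y) //= big1 => [|z zy].
    by rewrite addr0 !ffunE eqxx [_ *: _]mulr1.
  by rewrite !ffunE (inj_eq (pcan_inj kq)) eq_sym (negbTE zy); apply: scaler0.
- have [Z0 Zlin] := @supported_subspace F B (fun x => ~~ q x).
  split; first by split=> [|a x y /SE Sx /SE Sy]; apply/SE; [exact: Z0 | exact: Zlin].
  move=> f /SE suppf.
  exists [ffun x => if par x then 0 else f x], [ffun x => if par x then f x else 0].
  split; first split; first (apply/SE => x /suppf); try (move=> x);
    rewrite ?ffunE; try by case: (par x).
  + split; first (apply/SE => x /suppf); try (move=> x);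
    by rewrite ffunE; case: (par x).
  + by apply/ffunP=> x; rewrite !ffunE; case: (par x); rewrite ?add0r ?addr0.
- move=> f; split=> [/SE suppf|pf0]; last apply/SE => x.
    by apply/ffunP=> y; rewrite pk ffunE suppf // kq.
  rewrite negbK; case qx: (q x) => [y|//] _.
  by rewrite -[x]qk qx -pk pf0 ffunE.
- move=> f /SE suppf g /=; rewrite /bbr big1 // => x _; apply: big1 => y _.
  have [qx|nqx] := boolP (~~ q x); first by rewrite q_center // scaler0.
  by rewrite suppf // mul0r scale0r.
- move=> f /SE suppf D Dsub Dder; rewrite (bvec_sum f).
  have [D0 Dlin] := Dsub.
  elim/big_ind: _ => // [x y Dx Dy|x _]; first by rewrite -[x]scale1r; apply: Dlin.
  have [qx|nqx] := boolP (~~ q x); last by rewrite suppf // scale0r.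
  by rewrite -[_ *: _]addr0; apply: Dlin => //; apply: q_der.
Qed.

Lemma supported_sdim (Q : pred B) (S : A -> Prop) :
  (forall f, S f <-> supported Q f) ->
  has_sdim S (#|[pred x | Q x & ~~ par x]|, #|[pred x | Q x & par x]|).
Proof.
move=> SE; split; apply: supported_dim => f; split=> [[/SE Qf par_f]|Qf].
- move=> x; rewrite /= negb_and negbK => /orP[/Qf //|px].
  by apply: par_f; rewrite px.
- split=> [|x px]; first apply/SE => x /negbTE nQx; apply: Qf; first by rewrite /= nQx.
  by move: px; rewrite /= eqbF_neg negbK => ->; rewrite andbF.
- move=> x; rewrite /= negb_and => /orP[/Qf //|/negbTE px].
  by apply: par_f; rewrite px.
- split=> [|x px]; first apply/SE => x /negbTE nQx; apply: Qf; first by rewrite /= nQx.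
  by move: px; rewrite /= eqb_id => /negbTE ->; rewrite andbF.
Qed.

End BasisMaps.

(** * Lifting the generators of H(n) to a stem extension *)

Section Lifts.
Variables (F : fieldType) (n : nat) (E : extension (heis F n)).
Hypothesis stE : stem_extension E.
Local Notation p := (@ext_map _ _ E).
Local Notation u i := (bvec F (H_u i)).
Local Notation w i := (bvec F (H_w i)).

Lemma heis_lifts : exists a b : 'I_n -> ext_total E,
  [/\ forall i, homog false (a i), forall i, homog true (b i),
      forall i, p (a i) = u i & forall i, p (b i) = w i].
Proof.
have [[hom onto] _ _ _ _] := stE.
have /fin_all_exists[a aP] i : exists x, homog false x /\ p x = u i.
  by apply: homog_lift => //; apply: bvec_homog.
have /fin_all_exists[b bP] i : exists x, homog true x /\ p x = w i.
  by apply: homog_lift => //; apply: bvec_homog.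
by exists a, b; split=> i; case: (aP i) (bP i) => ? ? [].
Qed.

Lemma stem_center_l (s x : ext_total E) : ext_kernel s -> brk s x = 0.
Proof. by move=> Ss; have [_ _ _ Sc _] := stE; rewrite (Sc s Ss). Qed.

Lemma stem_kerP (s : ext_total E) : p s = 0 -> ext_kernel s.
Proof. by move=> ps; have [_ _ kE _ _] := stE; apply/kE. Qed.

End Lifts.

Lemma brk_swap0 (F : fieldType) (T : lieSuper F) b c (x y : T) :
  homog b x -> homog c y -> brk x y = 0 -> brk y x = 0.
Proof. by move=> hx hy xy; rewrite (brk_skew hy hx) xy scaler0 oppr0. Qed.

Lemma brk_antisym (F : fieldType) (T : lieSuper F) b c (x y : T) :
  homog b x -> homog c y -> b && c = false -> brk y x = - brk x y.
Proof. by move=> hx hy bc; rewrite (brk_skew hy hx) andbC bc scale1r. Qed.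

(** * The case n = 1 *)

Section Hat1.
Variable F : fieldType.

Definition hat1_proj (x : hat1_basis) : option (heis_basis 1) :=
  match x with
  | h1_a => Some (H_u ord0)
  | h1_b => Some (H_w ord0)
  | h1_c => Some H_z
  | h1_w | h1_m => None
  end.

Definition hat1_sect (y : heis_basis 1) : hat1_basis :=
  match y with H_u _ => h1_a | H_w _ => h1_b | H_z => h1_c end.

Lemma hat1_MHE (f : hat1 F) :
  hat1_MH f <-> supported (fun x => ~~ hat1_proj x) f.
Proof.
apply: span_supported => [[] // _|v [->|->]]; first by left.
- by right.
- by exists h1_w.
- by exists h1_m.
Qed.

Lemma hat1_mapE (f : hat1 F) :
  hat1_map f = linext (fun x => obvec F (hat1_proj x)) f.
Proof. by apply: eq_bigr => -[]. Qed.

Lemma hat1_stem : stem_extension (hat_extension F 1).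
Proof.
apply: (stem_of_basis_map (q := hat1_proj) (k := hat1_sect)) => //.
- by case=> [i||i] //=; rewrite [i]ord1.
- by case.
- exact: hat1_mapE.
- exact: hat1_MHE.
- by case.
- case=> [] [] /=; rewrite ?(linN (linext_lin _)) ?(lin0 (linext_lin _)) ?linext_bvec
    ?bbr_bvec ?bbr0l ?bbr0r ?oppr0 //=.
- by case.
- by case=> //= _ S _; apply; [exists (bvec F h1_b), (bvec F h1_b) |
    exists (bvec F h1_a), (bvec F h1_c)]; rewrite [RHS]bbr_bvec.
Qed.

Lemma hat1_sdim : has_sdim (@hat1_MH F) (1, 1)%N.
Proof.
have even : #|[pred x | ~~ hat1_proj x & ~~ hat1_par x]| = 1%N.
  by apply: (@eq_card1 _ h1_w) => x; apply/idP/eqP => [|->] //; case: x.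
have odd : #|[pred x | ~~ hat1_proj x & hat1_par x]| = 1%N.
  by apply: (@eq_card1 _ h1_m) => x; apply/idP/eqP => [|->] //; case: x.
by have := supported_sdim hat1_MHE; rewrite even odd.
Qed.

End Hat1.

(** The image of [hat1] is generated by lifts [a], [b]; the brackets that could
    deviate from those of [hat1], namely [[a, a]], [[c, b]] and [[c, c]], vanish
    by skew symmetry and the Jacobi identity. *)
Lemma hat1_weakly_initial (F : fieldType) :
  2%N \notin [pchar F] -> weakly_initial (hat_extension F 1).
Proof.
move=> char2 E st; have [a' [b' [ha hb pa pb]]] := heis_lifts st.
move: (a' ord0) (b' ord0) (ha ord0) (hb ord0) (pa ord0) (pb ord0).
move=> a b {}ha {}hb {}pa {}pb {a' b'}.
have [[[p_lin p_homog p_brk] _] _ _ _ _] := st.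
have S_l s x := @stem_center_l _ _ _ st s x.
have S_r s x := @stem_center_r _ _ _ x s st.
pose c := brk a b; pose m := brk a c; pose w := brk b b.
have hc : homog true c by exact: (brk_even ha hb).
have hm : homog true m by exact: (brk_even ha hc).
have hw : homog false w by exact: (brk_even hb hb).
have pc : ext_map c = bvec F H_z by rewrite p_brk pa pb [LHS]bbr_bvec.
have pm : ext_map m = 0 by rewrite p_brk pa pc [LHS]bbr_bvec.
have pw : ext_map w = 0 by rewrite p_brk pb [LHS]bbr_bvec.
have [Sm Sw] := (stem_kerP st pm, stem_kerP st pw).
have aa : brk a a = 0 by apply: eq_opp_eq0 char2 _; rewrite {1}(brk_skew ha ha) scale1r.
(* Jacobi for [a, b, b] with [[b, b]] central gives [[c, b] + [b, c] = 0], and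
   the bracket is symmetric on odd elements. *)
have cb : brk c b = 0.
  apply: eq_opp_eq0 char2 _; apply/eqP; rewrite -addr_eq0; apply/eqP.
  have := brk_jacobi b ha hb; rewrite [LHS]S_r // scale1r => /esym.
  by rewrite (brk_skew hb hc) scaleN1r opprK.
have ca : brk c a = - m by apply: brk_antisym ha hc _.
have bc := brk_swap0 hc hb cb.
have cc : brk c c = 0.
  by rewrite {2}/c (brk_jacobi _ hc ha) ca cb (linN (brk_linearl _)) S_l //
    (lin0 (brk_linearr _)) oppr0 scaler0 addr0.
have ba : brk b a = - c by apply: brk_antisym ha hb _.
pose phi x := match x with
  h1_a => a | h1_b => b | h1_c => c | h1_m => m | h1_w => w end.
exists (linext phi); split.
  apply: linext_lie_hom; case=> // -[] /=;
    rewrite ?(linN (linext_lin _)) ?(lin0 (linext_lin _)) ?linext_bvec //;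
    by rewrite ?(S_l m) ?(S_l w) ?(S_r m) ?(S_r w).
by apply: lin_linext => // -[].
Qed.

(** * The case n > 1 *)

(** Exchanging the two entries turns the strict inequality into the complement
    of the large one, so the two counts add up to that of all pairs. *)
Lemma card_lt_le_pairs n :
  (#|[pred s : 'I_n * 'I_n | (s.1 < s.2)%N]| +
   #|[pred s : 'I_n * 'I_n | (s.1 <= s.2)%N]| = n ^ 2)%N.
Proof.
have swapK : involutive (fun s : 'I_n * 'I_n => (s.2, s.1)) by case.
rewrite -!sum1_card (reindex_inj (can_inj swapK)) !sum1_card.
transitivity #|{: 'I_n * 'I_n}|; last by rewrite card_prod card_ord mulnn.
rewrite -(cardC [pred s : 'I_n * 'I_n | (s.2 < s.1)%N]); congr addn.
by apply: eq_card => s; rewrite !inE -leqNgt.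
Qed.

Lemma card_neq_pairs n :
  #|[pred s : 'I_n * 'I_n | s.1 != s.2]| = (n ^ 2 - n)%N.
Proof.
have diag : #|[pred s : 'I_n * 'I_n | s.1 == s.2]| = n.
  rewrite (@eq_card _ _ (mem (codom (fun i : 'I_n => (i, i))))) => [|s].
    by rewrite card_codom ?card_ord // => i j [].
  by apply/eqP/codomP => [|[i ->]//]; case: s => i j /= ->; exists j.
have := cardC [pred s : 'I_n * 'I_n | s.1 == s.2].
by rewrite diag card_prod card_ord mulnn => <-; rewrite addKn; apply: eq_card.
Qed.

Section Hatn.
Variables (F : fieldType) (n' : nat).
Local Notation n := n'.+2.

Definition hatn_proj (x : hatn_basis n) : option (heis_basis n) :=
  match x with
  | h_a i => Some (H_u i)
  | h_b i => Some (H_w i)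
  | h_c => Some H_z
  | h_yy _ | h_w _ | h_y _ | h_z _ => None
  end.

Definition hatn_sect (y : heis_basis n) : hatn_basis n :=
  match y with H_u i => h_a i | H_w i => h_b i | H_z => h_c end.

Lemma hatn_MHE (f : hatn F n) :
  hatn_MH f <-> supported (fun x => ~~ hatn_proj x) f.
Proof.
apply: span_supported => [[i|s|s|i||s|s] // _|v [[s ->]|[[s ->]|[[s ->]|[s ->]]]]].
- by left; exists s.
- by right; left; exists s.
- by right; right; left; exists s.
- by right; right; right; exists s.
- by exists (h_yy s).
- by exists (h_w s).
- by exists (h_y s).
- by exists (h_z s).
Qed.

Lemma hatn_mapE (f : hatn F n) :
  hatn_map f = linext (fun x => obvec F (hatn_proj x)) f.
Proof. by apply: eq_bigr => -[]. Qed.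

Section Values.
Variables (W : lmodType F) (phi : hatn_basis n -> W).

Lemma linext_yy g i j : (forall s, phi (h_yy s) = g (val s)) ->
  linext phi (v_yy F i j) = if (i < j)%N then g (i, j) else 0.
Proof. exact: linext_insub. Qed.

Lemma linext_w g i j : (forall s, phi (h_w s) = g (val s)) ->
  linext phi (v_w F i j) = if (i <= j)%N then g (i, j) else 0.
Proof. exact: linext_insub. Qed.

Lemma linext_ab gy gz i j :
  (forall s, phi (h_y s) = gy (val s)) -> (forall s, phi (h_z s) = gz (val s)) ->
  linext phi (hatn_ab F i j) =
  if i == j then phi h_c + (if (0 < i)%N then gy i else 0) else gz (i, j).
Proof.
move=> phi_y phi_z; rewrite /hatn_ab; case: eqP => [_|/eqP ij].
  by rewrite (linD (linext_lin _)) linext_bvec (linext_insub (g := gy)).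
by rewrite (linext_insub (g := gz)) //= ij.
Qed.

End Values.

Lemma obvec_insub (A : Type) (P : pred A) (S : subType P) (k : S -> hatn_basis n) s :
  obvec F (omap k (insub (val s))) = bvec F (k s).
Proof. by rewrite valK. Qed.

Lemma hatn_derived x : ~~ hatn_proj x -> @derived F (hatn F n) (bvec F x).
Proof.
have br (x1 x2 : hatn_basis n) (S : hatn F n -> Prop) :
    (forall y, (exists v1 v2, y = brk v1 v2) -> S y) -> S (hatn_br F x1 x2).
  by apply; exists (bvec F x1), (bvec F x2); rewrite [RHS]bbr_bvec.
case: x => [i|s|s|i||s|s] // _ S Ssub Sbr.
- suff -> : bvec F (h_yy s) = hatn_br F (h_a (val s).1) (h_a (val s).2) by exact: br.
  rewrite /= /v_yy -surjective_pairing obvec_insub insubF ?subr0 //.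
  by apply/negbTE; rewrite /= -leqNgt ltnW // (valP s).
- suff -> : bvec F (h_w s) = hatn_br F (h_b (val s).1) (h_b (val s).2) by exact: br.
  rewrite /= (valP s) /v_w -surjective_pairing; exact/esym/obvec_insub.
(* [c + y_i] and [c] are brackets, the latter since there is no [y_1]. *)
- suff -> : bvec F (h_y s) = (-1) *: hatn_br F (h_a ord0) (h_b ord0) +
      hatn_br F (h_a (val s)) (h_b (val s)).
    by apply: Ssub.2; exact: br.
  rewrite /= /hatn_ab !eqxx /v_y obvec_insub insubF // addr0.
  by rewrite scaleN1r addKr.
- suff -> : bvec F (h_z s) = hatn_br F (h_a (val s).1) (h_b (val s).2) by exact: br.
  rewrite /= /hatn_ab (negbTE (valP s)) /v_z -surjective_pairing.
  exact/esym/obvec_insub.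
Qed.

Lemma hatn_stem : stem_extension (hat_extension F n).
Proof.
apply: (stem_of_basis_map (q := hatn_proj) (k := hatn_sect)) => //.
- by case.
- by case.
- exact: hatn_mapE.
- exact: hatn_MHE.
- by case.
- have ab i j : linext (fun z => obvec F (hatn_proj z)) (hatn_ab F i j) =
      if i == j then bvec F H_z else 0.
    by rewrite (linext_ab (gy := fun=> 0) (gz := fun=> 0)) //= if_same addr0.
  case=> [i|s|s|i||s|s] [j|t|t|j||t|t] /=;
    rewrite ?bbr_bvec ?bbr0l ?bbr0r ?(lin0 (linext_lin _)) //=.
  + by rewrite (linB (linext_lin _)) !(linext_yy (g := fun=> 0)) // !if_same subr0.
  + by rewrite (linN (linext_lin _)) ab.
  + by case: ifP; rewrite (linext_w (g := fun=> 0)) // if_same.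
- by case=> [i|s|s|i||s|s] [j|t|t|j||t|t].
- exact: hatn_derived.
Qed.

Lemma hatn_sdim : has_sdim (@hatn_MH F n) (n ^ 2, n ^ 2 - 1)%N.
Proof.
have even : #|[pred x | ~~ hatn_proj x & ~~ hatn_par x]| = (n ^ 2)%N.
  pose g s := match s with inl s => h_yy s | inr s => @h_w n s end.
  rewrite (@eq_card _ _ (mem (codom g))) => [|x].
    rewrite card_codom => [|[s|s] [t|t] // [->] //].
    by rewrite card_sum !card_sig card_lt_le_pairs.
  apply/idP/codomP => [|[[s|s] ->] //].
  by case: x => // s _; [exists (inl s) | exists (inr s)].
have odd : #|[pred x | ~~ hatn_proj x & hatn_par x]| = (n ^ 2 - 1)%N.
  pose g s := match s with inl s => h_y s | inr s => @h_z n s end.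
  rewrite (@eq_card _ _ (mem (codom g))) => [|x].
    rewrite card_codom => [|[s|s] [t|t] // [->] //].
    rewrite card_sum !card_sig card_neq_pairs.
    rewrite (@eq_card _ _ (predC1 ord0)) ?cardC1 ?card_ord => [|i].
      by rewrite expnS expn1 !mulSn; lia.
    by rewrite !inE -lt0n.
  apply/idP/codomP => [|[[s|s] ->] //].
  by case: x => // s _; [exists (inl s) | exists (inr s)].
by have := supported_sdim hatn_MHE; rewrite even odd.
Qed.

(** As a second index is available, [c] commutes with every lift, so that all
    brackets of three lifts vanish as they do in [hatn]. *)
Lemma hatn_weakly_initial :
  2%N \notin [pchar F] -> weakly_initial (hat_extension F n).
Proof.
move=> char2 E st; have [a [b [ha hb pa pb]]] := heis_lifts st.
have [[[p_lin p_homog p_brk] _] _ _ _ _] := st.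
have S_l s x := @stem_center_l _ _ _ st s x.
have S_r s x := @stem_center_r _ _ _ x s st.
pose c := brk (a ord0) (b ord0).
have hab i j : homog true (brk (a i) (b j)) by exact: (brk_even (ha i) (hb j)).
have hc : homog true c by exact: hab.
have pab i j : ext_map (brk (a i) (b j)) = if i == j then bvec F H_z else 0.
  by rewrite p_brk pa pb [LHS]bbr_bvec.
have Saa i j : ext_kernel (brk (a i) (a j)).
  by apply: (stem_kerP st); rewrite p_brk !pa [LHS]bbr_bvec.
have Sbb i j : ext_kernel (brk (b i) (b j)).
  by apply: (stem_kerP st); rewrite p_brk !pb [LHS]bbr_bvec.
have Sab i j : i != j -> ext_kernel (brk (a i) (b j)).
  by move=> /negbTE ij; apply: (stem_kerP st); rewrite pab ij.
have Sy i : ext_kernel (brk (a i) (b i) - c).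
  by apply: (stem_kerP st); rewrite (linB p_lin) !pab !eqxx subrr.
have [other otherP] : exists f : 'I_n -> 'I_n, forall k, k != f k.
  exists (fun k => if k == ord0 then ord_max else ord0) => k.
  by have [->|] := eqVneq k ord0.
(* All the [[a_k, b_k]] lift [z], so they differ by central elements. *)
have brk_c k x : brk x c = brk x (brk (a k) (b k)).
  by apply/eqP; rewrite eq_sym -subr_eq0 -(linB (brk_linearr _)) S_r.
have ac k : brk (a k) c = 0.
  rewrite (brk_c (other k)) (brk_jacobi _ (ha _) (ha _)) S_l //.
  by rewrite S_r ?scaler0 ?addr0 //; apply/Sab/otherP.
have bc k : brk (b k) c = 0.
  have Sk : ext_kernel (brk (a (other k)) (b k)).
    by apply: Sab; rewrite eq_sym; apply: otherP.
  rewrite (brk_c (other k)) (brk_jacobi _ (hb _) (ha _)).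
  rewrite (brk_antisym (ha _) (hb _)) // (linN (brk_linearl _)).
  by rewrite (S_l _ _ Sk) (S_r _ _ (Sbb _ _)) scaler0 oppr0 addr0.
have ca k := brk_swap0 (ha k) hc (ac k).
have cb k := brk_swap0 (hb k) hc (bc k).
have cc : brk c c = 0.
  rewrite {2}/c (brk_jacobi _ hc (ha _)) ca cb (lin0 (brk_linearr _)) brkl0.
  by rewrite scaler0 addr0.
have aa i : brk (a i) (a i) = 0.
  by apply: eq_opp_eq0 char2 _; rewrite {1}(brk_skew (ha i) (ha i)) scale1r.
have aN i j : brk (a j) (a i) = - brk (a i) (a j) by apply: brk_antisym.
pose gyy (s : 'I_n * 'I_n) := brk (a s.1) (a s.2).
pose gw (s : 'I_n * 'I_n) := brk (b s.1) (b s.2).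
pose gy i := brk (a i) (b i) - c.
pose gz (s : 'I_n * 'I_n) := brk (a s.1) (b s.2).
pose phi x := match x with
  | h_a i => a i | h_b i => b i | h_c => c
  | h_yy s => gyy (val s) | h_w s => gw (val s)
  | h_y s => gy (val s) | h_z s => gz (val s) end.
have phi_ker x : ~~ hatn_proj x -> ext_kernel (phi x).
  by case: x => // s _; [exact: Saa | exact: Sbb | exact: Sy | exact/Sab/(valP s)].
have phi_ab i j : linext phi (hatn_ab F i j) = brk (a i) (b j).
  rewrite (linext_ab (gy := gy) (gz := gz)) //; case: eqP => // <-.
  case: posnP => [i0|_]; last by rewrite /= addrC subrK.
  by rewrite addr0 /= /c (_ : i = ord0) //; apply: val_inj.
have p_ker (s : ext_total E) : ext_kernel s -> ext_map s = 0.
  by have [_ _ kE _ _] := st; apply: (kE s).1.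
exists (linext phi); split; last first.
  apply: lin_linext => // -[i|s|s|i||s|s] /=; rewrite ?pa ?pb //.
  - exact/p_ker/(phi_ker (h_yy s)).
  - exact/p_ker/(phi_ker (h_w s)).
  - by rewrite pab eqxx.
  - exact/p_ker/(phi_ker (h_y s)).
  - exact/p_ker/(phi_ker (h_z s)).
apply: linext_lie_hom => [[i|s|s|i||s|s] //=|x y].
- exact: (brk_even (ha _) (ha _)).
- exact: (brk_even (hb _) (hb _)).
- exact: homogB.
- exact: hab.
have [qx|qx] := boolP (~~ hatn_proj x).
  rewrite S_l; last exact: phi_ker.
  suff -> : hatn_br F x y = 0 by rewrite (lin0 (linext_lin _)).
  by case: x y qx => [i|s|s|i||s|s] // [j|t|t|j||t|t].
have [qy|qy] := boolP (~~ hatn_proj y).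
  rewrite S_r; last exact: phi_ker.
  suff -> : hatn_br F x y = 0 by rewrite (lin0 (linext_lin _)).
  by case: x y qy {qx} => [i|s|s|i||s|s] // [j|t|t|j||t|t].
case: x y qx qy => [i|s|s|i||s|s] // [j|t|t|j||t|t] //= _ _;
  rewrite ?(linN (linext_lin _)) ?phi_ab ?(lin0 (linext_lin _)) //.
- rewrite (linB (linext_lin _)) !(linext_yy (g := gyy)) // /gyy /=.
  case: ltngtP => [||/val_inj->]; rewrite ?subr0 ?sub0r //.
- exact: (brk_antisym (ha j) (hb i)).
- case: leqP => ij; rewrite (linext_w (g := gw)) // ?ij ?(ltnW ij) // /gw /=.
  by rewrite (brk_skew (hb i) (hb j)) scaleN1r opprK.
Qed.

End Hatn.

(** * The cover of H(n) *)

Theorem theorem4p1 (F : fieldType) (n : nat) (hn : (0 < n)%N)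
    (char2 : 2%N \notin [pchar F]%R) (char3 : 3%N \notin [pchar F]%R) :
  maximal_stem_extension (hat_extension F n) /\
  (is_cover (heis F n) (hatH F n) /\
   forall T : lieSuper F, is_cover (heis F n) T -> lie_isomorphic T (hatH F n)) /\
  (forall (T : lieSuper F) (S : T -> Prop), is_multiplier (heis F n) S ->
     has_sdim S (if (2 <= n)%N then (n ^ 2, n ^ 2 - 1)%N else (1, 1)%N)).
Proof.
set d := (if (2 <= n)%N then _ else _).
have [st init dE] : [/\ stem_extension (hat_extension F n),
    weakly_initial (hat_extension F n) & has_sdim (@hatMH F n) d].
  rewrite {}/d; case: n hn => [//|[|n]] _.
    by split; [exact: hat1_stem | exact: hat1_weakly_initial | exact: hat1_sdim].
  by split; [exact: hatn_stem | exact: hatn_weakly_initial | exact: hatn_sdim].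
have max := weakly_initial_maximal st init dE.
split=> //; split=> [|T S]; last exact: (weakly_initial_multiplier st init dE).
split=> [|T]; last exact: (weakly_initial_cover st init dE).
by exists (@hatMH F n), (@hatH_map F n).
Qed.
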